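(* Let $n\ge 2$ and $2\le k\le n$ be integers, let $T>0$ and $a>0$, and put $$\alpha=-\frac{n}{n(k-1)+2k},\qquad \beta=-\frac{1}{n(k-1)+2k}.$$ If $k$ is even, let $$u(t,x)=(T-t)^{\alpha}\left(a^{\frac{k}{k-1}}-\frac{k-1}{2k}\left(\frac{|\beta|}{c_{n,k}}\right)^{\frac1k}\frac{|x|^2}{(T-t)^{2|\beta|}}\right)_{+}^{\frac{k}{k-1}},$$ and if $k$ is odd, let $$u(t,x)=(T-t)^{\alpha}\left(a^{\frac{k}{k-1}}+\frac{k-1}{2k}\left(\frac{|\beta|}{c_{n,k}}\right)^{\frac1k}\frac{|x|^2}{(T-t)^{2|\beta|}}\right)^{\frac{k}{k-1}}.$$ Then, in either case, $u$ is a self-similar solution of type II, in $(0,T)\times\mathbb{R}^n$, of the $k$-Hessian evolution equation $u_t=S_k(D^2u)$, and it blows up at the finite time $T$.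
   Context: Here $c_{n,k}=\frac1n\binom nk$ and $(y)_+=\max\{y,0\}$. $S_k(D^2u)$ is the $k$-Hessian operator in the space variable $x$, i.e. the $k$-th elementary symmetric function of the eigenvalues of the Hessian $D^2u$. For radially symmetric $u=u(t,r)$, $r=|x|$, it takes the form $S_k(D^2u)=c_{n,k}\,r^{1-n}\bigl(r^{n-k}(u_r)^k\bigr)_r$, and the equation is understood in this radial form, holding pointwise for $t\in(0,T)$ and $r>0$, with $u_r(t,0)=0$. A self-similar solution of type II is a solution of the form $u(t,x)=(T-t)^{\alpha}v(x(T-t)^{\beta})$ with $\alpha(k-1)+2k\beta=-1$. A solution $u$ blows up at time $T<\infty$ if $\lim_{t\uparrow T}\sup_{x\in\mathbb{R}^n}|u(t,x)|=\infty$ (the supremum being taken in $[0,\infty]$). *)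

(* Defs.v *)
From HB Require Import structures.
From mathcomp Require Import all_boot all_order all_algebra.
From mathcomp Require Import all_classical all_reals all_analysis.

Set Implicit Arguments.
Unset Strict Implicit.
Unset Printing Implicit Defensive.

Import Order.TTheory GRing.Theory Num.Theory.
Import numFieldNormedType.Exports.

Local Open Scope classical_set_scope.
Local Open Scope ring_scope.

(* The library norm `|x| on row vectors is the sup norm. *)
Definition enorm (R : realType) (n : nat) (x : 'rV[R]_n) : R :=
  Num.sqrt (\sum_(i < n) x 0 i ^+ 2).

(* c_{n,k} = (1/n) binom(n,k) *)
Definition cHess (R : realType) (n k : nat) : R := n%:R^-1 * 'C(n, k)%:R.

(* r^{n-k} (w')^k, whose derivative enters the radial k-Hessian; the natural
   number subtraction is exact for k <= n. *)
Definition radial_flux (R : realType) (n k : nat) (w : R -> R) (r : R) : R :=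
  r ^+ (n - k) * derive1 w r ^+ k.

(* S_k(D^2 w) at |x| = r > 0, for w a function of the radius:
   c_{n,k} r^{1-n} (r^{n-k} (w')^k)'. *)
Definition radial_hessian (R : realType) (n k : nat) (w : R -> R) (r : R) : R :=
  cHess R n k * r ^ (1 - n%:Z) * derive1 (radial_flux n k w) r.

(* u is radially symmetric on (0,T) x R^n and solves u_t = S_k(D^2 u) in radial
   form, pointwise for r > 0, with u_r(t,0) = 0. Since derive1 is total,
   existence of the three derivatives is required explicitly. Only the values
   U t r with r >= 0 matter (u_r(t,0) is a right derivative), and these are
   determined by u when n > 0. *)
Definition hessian_evolution_solution (R : realType) (n k : nat) (T : R)
    (u : R -> 'rV[R]_n -> R) : Prop :=
  exists U : R -> R -> R,
    [/\ forall (t : R) (x : 'rV[R]_n), 0 < t < T -> u t x = U t (enorm x),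
        forall t : R, 0 < t < T ->
          h^-1 * (U t h - U t 0) @[h --> 0^'+] --> (0 : R)
      & forall t r : R, 0 < t < T -> 0 < r ->
          [/\ derivable (fun s => U s r) t 1,
              derivable (U t) r 1,
              derivable (radial_flux n k (U t)) r 1
            & derive1 (fun s => U s r) t = radial_hessian n k (U t) r]].

Definition self_similar_solution_II (R : realType) (n k : nat)
    (T alpha beta : R) (u : R -> 'rV[R]_n -> R) : Prop :=
  [/\ hessian_evolution_solution k T u,
      alpha * (k%:R - 1) + 2 * k%:R * beta = -1
    & exists v : 'rV[R]_n -> R,
        forall (t : R) (x : 'rV[R]_n), 0 < t < T ->
        u t x = (T - t) `^ alpha * v ((T - t) `^ beta *: x)].

Definition blows_up_at (R : realType) (n : nat) (T : R)
    (u : R -> 'rV[R]_n -> R) : Prop :=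
  ereal_sup [set (`|u t x|)%:E | x in [set: 'rV[R]_n]] @[t --> T^'-]
    --> (+oo : \bar R)%E.

(* Main.v *)
Require Import Defs.
From HB Require Import structures.
From mathcomp Require Import all_boot all_order all_algebra.
From mathcomp Require Import all_classical all_reals all_analysis.
From mathcomp Require Import ring lra.

Set Implicit Arguments.
Unset Strict Implicit.
Unset Printing Implicit Defensive.

Import Order.TTheory GRing.Theory Num.Theory.
Import numFieldNormedType.Exports.

Local Open Scope classical_set_scope.
Local Open Scope ring_scope.

(** Write [s = T - t]. For [u(t, x) = s^alpha phi(s^beta |x|)] with
    [alpha = n beta], the time derivative is a total derivative in [r]:
    [u_t = - beta s^(alpha-1) r^(1-n) (r^n phi(s^beta r))_r].
    The radial k-Hessian is [c r^(1-n) (r^(n-k) u_r^k)_r], [c] being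
    [cHess R n k]. The equation therefore holds as soon as the two expressions
    under [(.)_r] agree, and for a type II scaling the powers of [s] match, so
    that what remains is the first-order equation
    [phi'(xi)^k = (- beta / c) xi^k phi(xi)]
    ([self_similar_solves]).

    The function [phi(xi) = (A + m xi^2)_+^p] with [p = k / (k - 1)] satisfies
    it when [(2 p m)^k = - beta / c]: since [k (p - 1) = p], raising
    [phi' = 2 p m xi (A + m xi^2)_+^(p-1)] to the power [k] reproduces [phi]
    ([power_profile_eq]). As [p > 1], the positive part does not spoil
    differentiability at the free boundary ([pospow_is_derive]). For even [k]
    both signs of [m] are allowed and the negative one is taken; for odd [k]
    only [m > 0] is, and then the positive part is the identity.

    Blow-up is seen at the origin, where [u(t, 0) = s^alpha phi(0)] with
    [alpha < 0] and [phi(0) <> 0] ([self_similar_blows_up]). *)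

(** * Powers of the positive part *)

Definition pospow (R : realType) (q y : R) : R := (Num.max y 0) `^ q.

(** At [y = 0] the function is [y] times [(y)_+^(q-1)], and the second factor is
    continuous there with value [0] because [q > 1]. *)
Lemma pospow_is_derive (R : realType) (q y : R) : 1 < q ->
  is_derive y 1 (pospow q) (q * pospow (q - 1) y).
Proof.
move=> q1; have q0 : 0 < q by lra.
have q10 : 0 < q - 1 by lra.
rewrite /pospow; have [y0|y0|->] := ltgtP y 0.
- rewrite powR0 ?gt_eqF// mulr0.
  apply: (near_eq_is_derive _ (@is_derive_cst R R R 0 y 1)).
  near=> z; have z0 : z < 0 by near: z; exact: lt_nbhsl.
  by rewrite (max_idPr (ltW z0)) powR0 ?gt_eqF.
- apply: (near_eq_is_derive _ (is_derive1_powR q y0)).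
  near=> z; have z0 : 0 < z by near: z; exact: lt_nbhsr.
  by rewrite (max_idPl (ltW z0)).
rewrite powR0 ?gt_eqF// mulr0.
apply/is_derive1_caratheodory; exists (fun z : R => (Num.max z 0) `^ (q - 1)).
rewrite /= maxxx !powR0 ?gt_eqF//; split=> //.
- move=> z /=; rewrite !subr0; have [z0|z0] := leP z 0.
    by rewrite !powR0 ?gt_eqF// mul0r.
  by rewrite mulrC mulr_powRB1// ltW.
- suff : Num.max z 0 `^ (q - 1) @[z --> 0] --> Num.max 0 0 `^ (q - 1) by [].
  rewrite maxxx powR0 ?gt_eqF//.
  apply/cvgrPdist_lt => e e0; near=> z.
  rewrite sub0r normrN ger0_norm ?powR_ge0//.
  have [z0|z0] := leP z 0; first by rewrite powR0 ?gt_eqF.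
  (* The inequality z^(q-1) < e amounts to z < e^(1/(q-1)). *)
  have -> : e = (e `^ (q - 1)^-1) `^ (q - 1).
    by rewrite -powRrM mulVf ?powRr1 ?gt_eqF// ltW.
  apply: gt0_ltr_powR => //; rewrite ?nnegrE ?powR_ge0 ?ltW//.
  near: z; apply: lt_nbhsl; exact: powR_gt0.
Unshelve. all: by end_near. Qed.

Lemma pospow_exprn (R : realType) (q y : R) (k : nat) :
  pospow q y ^+ k = pospow (q * k%:R) y.
Proof. by rewrite /pospow powRrM powR_mulrn// powR_ge0. Qed.

(** * Self-similar functions *)

Lemma enormZ (R : realType) (n : nat) (c : R) (x : 'rV[R]_n) :
  enorm (c *: x) = `|c| * enorm x.
Proof.
rewrite /enorm -sqrtr_sqr -sqrtrM ?sqr_ge0// mulr_sumr.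
by congr Num.sqrt; apply: eq_bigr => i _; rewrite mxE exprMn.
Qed.

Lemma enorm0 (R : realType) (n : nat) : enorm (0 : 'rV[R]_n) = 0.
Proof.
rewrite /enorm big1 ?sqrtr0// => i _.
by rewrite mxE expr0n.
Qed.

Definition radial_self_similar (R : realType) (T alpha beta : R)
    (phi : R -> R) (t r : R) : R :=
  (T - t) `^ alpha * phi ((T - t) `^ beta * r).

Definition self_similar (R : realType) (n : nat) (T alpha beta : R)
    (phi : R -> R) (t : R) (x : 'rV[R]_n) : R :=
  radial_self_similar T alpha beta phi t (enorm x).

Lemma is_derive_powR_sub (R : realType) (T t c : R) : t < T ->
  is_derive t 1 (fun s : R => (T - s) `^ c) (- c * (T - t) `^ (c - 1)).
Proof.
move=> tT; have s0 : 0 < T - t by lra.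
have := @is_derive1_comp _ (@powR R ^~ c) (fun s => T - s) t _ _
  (is_derive1_powR c s0) (is_deriveB (is_derive_cst T t 1) (is_derive_id t 1)).
by rewrite sub0r mulrN1 mulNr.
Qed.

Lemma is_derive_scale (R : realType) (c r : R) :
  is_derive r 1 (fun r : R => c * r) c.
Proof.
apply: is_derive_eq (is_deriveZ c (is_derive_id r 1)) _.
exact: mulr1.
Qed.

(** * Reduction of the equation to a first-order profile equation *)

Section profile.
Variables (R : realType) (n k : nat) (T alpha beta : R) (phi dphi : R -> R).
Hypotheses (k_gt0 : (0 < k)%N) (kn : (k <= n)%N).
Hypothesis alphaE : alpha = n%:R * beta.
Hypothesis scaling : alpha * (k%:R - 1) + 2 * k%:R * beta = -1.
Hypothesis phi_derive : forall xi : R, is_derive xi 1 phi (dphi xi).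
Hypothesis profile_eq :
  forall xi, dphi xi ^+ k = - beta / cHess R n k * xi ^+ k * phi xi.

Let U := radial_self_similar T alpha beta phi.

Lemma cHess_neq0 : cHess R n k != 0.
Proof.
by rewrite mulf_neq0 ?invr_eq0 ?pnatr_eq0 -?lt0n ?bin_gt0// (leq_trans k_gt0).
Qed.

Lemma is_derive_space (t r : R) : t < T ->
  is_derive r 1 (U t) ((T - t) `^ (alpha + beta) * dphi ((T - t) `^ beta * r)).
Proof.
move=> tT; have s0 : T - t != 0 by rewrite gt_eqF// subr_gt0.
have dlin := is_derive_scale ((T - t) `^ beta) r.
apply: is_derive_eq
  (is_deriveZ ((T - t) `^ alpha) (is_derive1_comp (phi_derive _) dlin)) _.
rewrite /GRing.scale /= powRD; last by rewrite s0 implybT.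
by rewrite -mulrA [dphi _ * _]mulrC.
Qed.

(** The bracket is [r^(1-n)] times the [r]-derivative of [r^n phi(s^beta r)];
    this is where [alpha = n beta] is used. *)
Lemma is_derive_time (t r : R) : t < T ->
  is_derive t 1 (U ^~ r)
    (- beta * (T - t) `^ (alpha - 1) *
      (n%:R * phi ((T - t) `^ beta * r) +
       (T - t) `^ beta * r * dphi ((T - t) `^ beta * r))).
Proof.
move=> tT; have s0 : T - t != 0 by rewrite gt_eqF// subr_gt0.
have s_ge0 : 0 <= T - t by rewrite subr_ge0 ltW.
have dlin : is_derive t 1 (fun t : R => (T - t) `^ beta * r)
    (- beta * (T - t) `^ (beta - 1) * r).
  apply: is_derive_eq
    (is_deriveM (is_derive_powR_sub beta tT) (is_derive_cst r t 1)) _.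
  by rewrite /GRing.scale /= mulr0 add0r mulrC.
apply: is_derive_eq (is_deriveM (is_derive_powR_sub alpha tT)
  (is_derive1_comp (phi_derive _) dlin)) _.
rewrite /GRing.scale /= !powRB ?s0 ?implybT// powRr1// alphaE.
by field.
Qed.

(** The flux carries [s^(k (alpha + beta))] from [u_r^k] and [s^(k beta)] from
    [xi^k]; the type II relation makes the total exponent [alpha - 1]. *)
Lemma radial_flux_profile (t r : R) : t < T ->
  radial_flux n k (U t) r =
    - beta / cHess R n k * (T - t) `^ (alpha - 1) *
      (r ^+ n * phi ((T - t) `^ beta * r)).
Proof.
move=> tT; have s0 : T - t != 0 by rewrite gt_eqF// subr_gt0.
have dU := is_derive_space r tT.
rewrite /radial_flux derive1E derive_val exprMn profile_eq exprMn.
have -> : alpha - 1 = (alpha + beta) * k%:R + beta * k%:R.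
  by rewrite -scaling; ring.
rewrite (@powRD _ _ ((alpha + beta) * _)) ?s0 ?implybT//.
rewrite !powRrM !powR_mulrn ?powR_ge0//.
have -> : r ^+ n = r ^+ (n - k) * r ^+ k by rewrite -exprD subnK.
by ring.
Qed.

Lemma is_derive_flux (t r : R) : t < T ->
  is_derive r 1 (radial_flux n k (U t))
   (- beta / cHess R n k * (T - t) `^ (alpha - 1) *
      (r ^+ n.-1 * (n%:R * phi ((T - t) `^ beta * r) +
       (T - t) `^ beta * r * dphi ((T - t) `^ beta * r)))).
Proof.
move=> tT; have n0 : (0 < n)%N by exact: leq_trans kn.
have -> : radial_flux n k (U t) = (fun r =>
    - beta / cHess R n k * (T - t) `^ (alpha - 1) *
      (r ^+ n * phi ((T - t) `^ beta * r))).
  by apply/funext => x; exact: radial_flux_profile.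
have dlin := is_derive_scale ((T - t) `^ beta) r.
have dX : is_derive r 1 (fun r : R => r ^+ n) (n%:R * r ^+ n.-1).
  have := is_deriveX n (is_derive_id r 1).
  by rewrite exprfctE /GRing.scale /= mulr1.
set c := - beta / _ * _.
apply: is_derive_eq (is_deriveZ c (is_deriveM dX
  (is_derive1_comp (phi_derive _) dlin))) _.
rewrite /GRing.scale /=; congr (_ * _).
have -> : r ^+ n = r * r ^+ n.-1 by rewrite -exprS prednK.
by ring.
Qed.

Lemma self_similar_solves :
  self_similar_solution_II k T alpha beta (@self_similar R n T alpha beta phi).
Proof.
split=> //; last first.
  exists (fun y => phi (enorm y)) => t x /andP[_ tT].
  by rewrite /self_similar /radial_self_similar enormZ ger0_norm ?powR_ge0.
(* The profile equation at the origin forces u_r(t, 0) = 0. *)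
have dphi0 : dphi 0 = 0.
  have /eqP := profile_eq 0.
  by rewrite expr0n gtn_eqF// mulr0 mul0r expf_eq0 k_gt0 => /eqP.
exists U; split=> [//|t /andP[_ tT]|t r /andP[_ tT] r0].
- have := is_derive_space 0 tT; rewrite mulr0 dphi0 mulr0 => -[dU dU0].
  apply: cvg_dnbhs_at_right.
  have -> : (fun h => h^-1 * (U t h - U t 0)) =
      (fun h => h^-1 *: ((U t \o shift 0) (h *: 1) - U t 0)).
    by apply/funext => h /=; rewrite addr0 [h%:A]mulr1.
  by rewrite -[X in _ --> X]dU0; exact: dU.
have dt := is_derive_time r tT; have dr := is_derive_space r tT.
have df := is_derive_flux r tT.
split; [exact: ex_derive|exact: ex_derive|exact: ex_derive|].
rewrite /radial_hessian !derive1E !derive_val.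
have c0 := cHess_neq0.
have n0 : (0 < n)%N by exact: leq_trans kn.
have -> : r ^ (1 - n%:Z) = (r ^+ n.-1)^-1.
  by rewrite -[in LHS](prednK n0) -addn1 PoszD opprD addrCA subrr addr0 -exprnN.
have rn0 : r ^+ n.-1 != 0 by rewrite expf_neq0// gt_eqF.
by field; rewrite rn0 c0.
Qed.

End profile.

(** * Blow-up *)

Lemma self_similar_blows_up (R : realType) (n : nat) (T alpha beta : R)
    (phi : R -> R) : alpha < 0 -> phi 0 != 0 ->
  blows_up_at T (@self_similar R n T alpha beta phi).
Proof.
move=> alpha0 phi0; apply/cvgeyPge => A.
(* The bound is replaced by a positive one so that it can be inverted. *)
pose B := Num.max A 1; have B0 : 0 < B by rewrite lt_max ltr01 orbT.
have N0 : 0 < `|phi 0| by rewrite normr_gt0.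
near=> t; have tT : t < T by [].
apply: (@le_trans _ _ (`|self_similar T alpha beta phi t (0 : 'rV_n)|)%:E); last first.
  by apply: ereal_sup_ubound; exists 0.
rewrite lee_fin /self_similar /radial_self_similar enorm0 mulr0.
rewrite normrM ger0_norm ?powR_ge0//.
apply: (@le_trans _ _ B); first by rewrite le_max lexx.
rewrite -[alpha]opprK powRN mulrC ler_pdivlMr ?powR_gt0 ?subr_gt0//.
rewrite mulrC -ler_pdivlMr//.
(* The inequality s^(-alpha) <= |phi 0| / B holds once s is below the
   (-alpha)-th root of the right-hand side. *)
have -> : `|phi 0| / B = ((`|phi 0| / B) `^ (- alpha)^-1) `^ (- alpha).
  by rewrite -powRrM mulVf ?oppr_eq0 ?lt_eqF// powRr1// ltW// divr_gt0.
apply: ge0_ler_powR; rewrite ?nnegrE ?powR_ge0 ?oppr_ge0 ?subr_ge0 ?ltW//.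
by near: t; apply: nbhs_left_ltBl; rewrite powR_gt0// divr_gt0.
Unshelve. all: by end_near. Qed.

(** * The explicit profile *)

Definition power_profile (R : realType) (p A m xi : R) : R :=
  pospow p (A + m * xi ^+ 2).

Lemma power_profile_is_derive (R : realType) (p A m xi : R) : 1 < p ->
  is_derive xi 1 (power_profile p A m)
    (2 * p * m * xi * power_profile (p - 1) A m xi).
Proof.
move=> p1.
have dX : is_derive xi 1 (fun x : R => x * x) (xi + xi).
  apply: is_derive_eq (is_deriveM (is_derive_id xi 1) (is_derive_id xi 1)) _.
  by rewrite /GRing.scale /= mulr1.
have dq : is_derive xi 1 (fun x : R => A + m * x ^+ 2) (m * (xi + xi)).
  apply: is_derive_eq (is_deriveD (is_derive_cst A xi 1) (is_deriveZ m dX)) _.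
  exact: add0r.
apply: is_derive_eq (is_derive1_comp (pospow_is_derive _ p1) dq) _.
by rewrite /power_profile; ring.
Qed.

(** The exponent [p = k / (k - 1)] is the one with [k (p - 1) = p]. *)
Lemma power_profile_eq (R : realType) (k : nat) (A m xi : R) : (2 <= k)%N ->
  let p : R := k%:R / (k%:R - 1) in
  (2 * p * m * xi * power_profile (p - 1) A m xi) ^+ k =
    (2 * p * m) ^+ k * xi ^+ k * power_profile p A m xi.
Proof.
move=> k2 p; rewrite 2!exprMn pospow_exprn.
suff -> : (p - 1) * k%:R = p by [].
have k1 : (1 : R) < k%:R by rewrite ltr1n.
by rewrite /p; field; lra.
Qed.

Lemma power_profile_type_II_blow_up (R : realType) (n k : nat)
    (T A alpha beta m : R) (p := k%:R / (k%:R - 1)) :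
  (2 <= k)%N -> (k <= n)%N -> 0 < A -> beta < 0 -> alpha = n%:R * beta ->
  alpha * (k%:R - 1) + 2 * k%:R * beta = -1 ->
  (2 * p * m) ^+ k = - beta / cHess R n k ->
  let u := @self_similar R n T alpha beta (power_profile p A m) in
  self_similar_solution_II k T alpha beta u /\ blows_up_at T u.
Proof.
move=> k2 kn A0 beta0 alphaE scaling mE u.
have k_gt0 : (0 < k)%N by exact: leq_trans k2.
have n_gt0 : (0 < n)%N by exact: leq_trans kn.
have k1 : (1 : R) < k%:R by rewrite ltr1n.
have p1 : 1 < p by rewrite /p ltr_pdivlMr; lra.
split.
  apply: (self_similar_solves T k_gt0 kn alphaE scaling
    (fun xi => power_profile_is_derive A m xi p1)) => xi.
  by rewrite power_profile_eq// mE.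
apply: self_similar_blows_up.
  by rewrite alphaE nmulr_llt0// ltr0n.
rewrite /power_profile /pospow expr0n mulr0 addr0 gt_eqF// powR_gt0//.
by rewrite lt_max A0.
Qed.

(** Valid for every [s], since [s `^ beta] is nonnegative even at negative base;
    so the closed formula for [u] and its self-similar form agree for all [t],
    not only for [t < T]. *)
Lemma parabolic_scaling (R : realType) (s beta r : R) : beta <= 0 ->
  r ^+ 2 / s `^ (2 * `|beta|) = (s `^ beta * r) ^+ 2.
Proof.
move=> beta0; rewrite ler0_norm// mulrN powRN invrK [2 * _]mulrC powRrM.
by rewrite powR_mulrn ?powR_ge0// exprMn mulrC.
Qed.

Theorem mainTheorem6 (R : realType) (n k : nat) (T a : R)
    (hn : (2 <= n)%N) (hk2 : (2 <= k)%N) (hkn : (k <= n)%N)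
    (hT : 0 < T) (ha : 0 < a) :
  let alpha : R := - (n%:R / (n%:R * (k%:R - 1) + 2 * k%:R)) in
  let beta : R := - (1 / (n%:R * (k%:R - 1) + 2 * k%:R)) in
  let p : R := k%:R / (k%:R - 1) in
  let b : R := (k%:R - 1) / (2 * k%:R)
               * (`|beta| / cHess R n k) `^ (1 / k%:R) in
  let u_even : R -> 'rV[R]_n -> R := fun t x =>
    (T - t) `^ alpha *
    (Num.max (a `^ p - b * (enorm x ^+ 2 / (T - t) `^ (2 * `|beta|))) 0) `^ p in
  let u_odd : R -> 'rV[R]_n -> R := fun t x =>
    (T - t) `^ alpha *
    (a `^ p + b * (enorm x ^+ 2 / (T - t) `^ (2 * `|beta|))) `^ p in
  (~~ odd k ->
     self_similar_solution_II k T alpha beta u_even /\ blows_up_at T u_even) /\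
  (odd k ->
     self_similar_solution_II k T alpha beta u_odd /\ blows_up_at T u_odd).
Proof.
move=> alpha beta p b u_even u_odd.
have k1 : (1 : R) < k%:R by rewrite ltr1n.
have n1 : (1 : R) < n%:R by rewrite ltr1n.
have D0 : 0 < n%:R * (k%:R - 1) + 2 * k%:R :> R.
  by rewrite addr_gt0// mulr_gt0; lra.
have beta0 : beta < 0 by rewrite oppr_lt0 divr_gt0.
have alphaE : alpha = n%:R * beta by rewrite mulrN mulrA mulr1.
have scaling : alpha * (k%:R - 1) + 2 * k%:R * beta = -1.
  by rewrite /alpha /beta; field; rewrite gt_eqF.
have c0 : 0 < cHess R n k.
  by rewrite mulr_gt0 ?invr_gt0 ?ltr0n ?bin_gt0// (leq_trans _ hn).
have b0 : 0 <= b by rewrite mulr_ge0 ?powR_ge0// divr_ge0; lra.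
(* The constant b is chosen so that 2 p b is the k-th root of |beta| / c. *)
have bE : (2 * p * b) ^+ k = - beta / cHess R n k.
  have -> : 2 * p * b = (`|beta| / cHess R n k) `^ (1 / k%:R).
    by rewrite /b /p; field; apply/andP; split; lra.
  rewrite -powR_mulrn ?powR_ge0// -powRrM mul1r mulVf; last by lra.
  by rewrite ltr0_norm// powRr1// divr_ge0 ?oppr_ge0 ?ltW.
have ap0 : 0 < a `^ p by exact: powR_gt0.
split=> k_parity.
- have -> : u_even = @self_similar R n T alpha beta (power_profile p (a `^ p) (- b)).
    apply/funext => t; apply/funext => x.
    by rewrite /u_even (parabolic_scaling _ _ (ltW beta0)) -mulNr.
  apply: power_profile_type_II_blow_up => //.
  by rewrite mulrN exprNn -signr_odd (negbTE k_parity) mul1r.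
- have -> : u_odd = @self_similar R n T alpha beta (power_profile p (a `^ p) b).
    apply/funext => t; apply/funext => x.
    rewrite /u_odd (parabolic_scaling _ _ (ltW beta0)).
    congr (_ * powR _ _); apply/esym/max_idPl.
    by apply: addr_ge0; [exact: ltW|rewrite mulr_ge0 ?sqr_ge0].
  exact: power_profile_type_II_blow_up.
Qed.
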